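(* Let $\mathfrak{n}_0=U\oplus\mathfrak{g}_0$ be the real 2-step nilpotent metric Lie algebra with Chevalley rational structure $\mathfrak{n}_{0,\mathbb{Q}}$ described in the context. Let $\lambda\in\Lambda$ and $0\neq u\in U_\lambda$. Let $\mathfrak{n}_0(u,\lambda)=\mathbb{R}\text{-span}\{u,\tilde H_\lambda(u),\tilde H_\lambda\}$. If $2\lambda\notin\Phi$, then $\mathfrak{n}_0(u,\lambda)$ is a 3-dimensional, totally geodesic subalgebra of $\mathfrak{n}_0$ with 1-dimensional center. If $u\in\mathbb{Q}\text{-span}(\mathfrak{B}_\lambda)$, then $\mathfrak{n}_0(u,\lambda)$ is a rational subalgebra of $\mathfrak{n}_0$ with respect to the Chevalley rational structure $\mathfrak{n}_{0,\mathbb{Q}}$ on $\mathfrak{n}_0$ (i.e. it has a basis contained in $\mathfrak{n}_{0,\mathbb{Q}}$).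
   Context: The hypothesis $2\lambda\notin\Phi$ is in force for both assertions. $\mathfrak{g}_0$ is a compact semisimple real Lie algebra with Killing form $B_0$ (negative definite), $U$ a finite dimensional real $\mathfrak{g}_0$-module, $\mathfrak{h}_0$ a maximal abelian subalgebra of $\mathfrak{g}_0$, $\mathfrak{h}=\mathfrak{h}_0^{\mathbb{C}}$, $\mathfrak{g}=\mathfrak{g}_0^{\mathbb{C}}$, $V=U^{\mathbb{C}}$; $\Phi$ are the roots of $\mathfrak{h}$ with base $\Delta$ and positive roots $\Phi^+$, $\Lambda$ the nonzero weights of $V$; $V_\lambda=\{v\in V:Hv=\lambda(H)v\ \forall H\in\mathfrak{h}\}$, $U_\lambda=(V_\lambda\oplus V_{-\lambda})\cap U$, $U_0=V_0\cap U$. Compact Chevalley basis: $\tau_\alpha=2H_\alpha/B(H_\alpha,H_\alpha)$ with $B$ the Killing form of $\mathfrak{g}$, $B(H,H_\alpha)=\alpha(H)$. Let $\{X_\beta:\beta\in\Phi;\tau_\alpha:\alpha\in\Delta\}$ be a basis of $\mathfrak{g}$ with $X_\beta\in\mathfrak{g}_\beta$, $[X_\alpha,X_{-\alpha}]=\tau_\alpha$, $[X_\alpha,X_\beta]=C_{\alpha,\beta}X_{\alpha+\beta}$ with $C_{\alpha,\beta}=-C_{-\alpha,-\beta}$ whenever $\alpha,\beta,\alpha+\beta\in\Phi$, such that $\mathfrak{C}_0=\{\tilde\tau_\alpha=i\tau_\alpha:\alpha\in\Delta;\ X_\beta-X_{-\beta},\ iX_\beta+iX_{-\beta}:\beta\in\Phi^+\}$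 is an $\mathbb{R}$-basis of $\mathfrak{g}_0$. $\mathfrak{B}_0$ is a basis of $U$ such that $\mathfrak{C}_0$ leaves $\mathbb{Q}\text{-span}(\mathfrak{B}_0)$ invariant and $\mathfrak{B}_0$ is a union of a basis of $U_0$ and bases $\mathfrak{B}_\mu$ of $U_\mu$, $\mu\in\Lambda$. The Chevalley rational structure is $\mathfrak{n}_{0,\mathbb{Q}}=\mathbb{Q}\text{-span}(\mathfrak{B}_0\cup\mathfrak{C}_0)$. $\langle\,,\rangle$ is an inner product on $\mathfrak{n}_0$ such that $U\perp\mathfrak{g}_0$, every $X\in\mathfrak{g}_0$ is skew symmetric on $U$, $\langle\,,\rangle=-B_0$ on $\mathfrak{g}_0$, and $\langle\xi,\xi'\rangle\in\mathbb{Q}$ for all $\xi,\xi'\in\mathfrak{B}_0\cup\mathfrak{C}_0$. The bracket on $\mathfrak{n}_0$: $\mathfrak{g}_0$ is central, $[\mathfrak{n}_0,\mathfrak{n}_0]\subseteq\mathfrak{g}_0$, $\langle[u,u'],Z\rangle=\langle Z(u),u'\rangle$ for $u,u'\in U$, $Z\in\mathfrak{g}_0$. $\tilde H_\lambda\in\mathfrak{h}_0$ is the unique vector with $\langle\tilde H,\tilde H_\lambda\rangle=-i\lambda(\tilde H)$ for all $\tilde H\in\mathfrak{h}_0$; $\tilde H_\lambda(u)$ is its module action on $u$. Let $N_0$ be the simply connected Lie group with Lie algebra $\mathfrak{n}_0$ and the left invariant metric determined by $\langle\,,\rangle$. A subalgebra $\mathfrak{n}_0^*$ is totally geodesic if the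 subgroup $\exp(\mathfrak{n}_0^* )$ is a totally geodesic submanifold of $N_0$; equivalently $\nabla_XY\in\mathfrak{n}_0^*$ for all $X,Y\in\mathfrak{n}_0^*$, with $\nabla$ the Levi-Civita connection on left invariant fields. *)

(* Defs.v *)
From HB Require Import structures.
From mathcomp Require Import all_boot all_order all_algebra.
From mathcomp Require Import complex.
From mathcomp Require Import boolp classical_sets reals.

Set Implicit Arguments.
Unset Strict Implicit.
Unset Printing Implicit Defensive.

Import Order.TTheory GRing.Theory Num.Theory VectorInternalTheory.

Local Open Scope classical_set_scope.
Local Open Scope ring_scope.
Local Open Scope complex_scope.

(* The pair (x, y) : cplx V stands for x + i y in the complexification of V. *)
Definition cplx (R : rcfType) (V : lmodType R) : Type := (V * V)%type.

HB.instance Definition _ (R : rcfType) (V : lmodType R) :=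
  GRing.Zmodule.copy (cplx V) (V * V)%type.

Section Complexification.
Variable R : rcfType.

Section Lmodule.
Variable V : lmodType R.

Definition cplx_scale (c : R[i]) (v : cplx V) : cplx V :=
  (complex.Re c *: v.1 - complex.Im c *: v.2,
   complex.Re c *: v.2 + complex.Im c *: v.1).

Fact cplx_scaleA a b v : cplx_scale a (cplx_scale b v) = cplx_scale (a * b) v.
Proof.
case: a b v => [a1 a2] [b1 b2] [x y]; congr (_, _) => /=;
  rewrite !(scalerBr, scalerDr) !(scalerBl, scalerDl) !scalerA ?opprD.
  by rewrite [- _ - _]addrC addrACA.
by rewrite [X in _ + X = _]addrC addrACA.
Qed.

Fact cplx_scale1 : left_id 1 cplx_scale.
Proof. by case=> x y; rewrite /cplx_scale /= !scale1r !scale0r subr0 addr0. Qed.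

Fact cplx_scaleDr : right_distributive cplx_scale +%R.
Proof.
by move=> c [x y] [x' y']; congr (_, _); rewrite /= !scalerDr ?opprD addrACA.
Qed.

Fact cplx_scaleDl v : {morph cplx_scale^~ v : a b / a + b}.
Proof.
move=> [a1 a2] [b1 b2]; congr (_, _);
  by rewrite /= !scalerDl ?opprD addrACA.
Qed.

HB.instance Definition _ := GRing.Zmodule_isLmodule.Build R[i] (cplx V)
  cplx_scaleA cplx_scale1 cplx_scaleDr cplx_scaleDl.

Definition cplx_of (x : V) : cplx V := (x, 0).

End Lmodule.

Fact cplx_vect_iso (V : vectType R) : Vector.axiom (dim V) (cplx V).
Proof.
pose c2r (v : cplx V) : 'rV[R[i]]_(dim V) :=
  \row_j Complex (v2r (v.1 : V) 0 j) (v2r (v.2 : V) 0 j).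
pose r2c (w : 'rV[R[i]]_(dim V)) : cplx V :=
  (r2v (map_mx (@complex.Re R) w), r2v (map_mx (@complex.Im R) w)).
exists c2r.
  move=> [a b] [x y] [x' y']; apply/rowP=> j.
  rewrite !mxE /= !linearD /= !linearN /= !linearZ /= !mxE.
  by rewrite mulrN; congr Complex; rewrite -addrA.
exists r2c.
  move=> [x y]; congr (_, _); rewrite /= -[RHS]v2rK; congr r2v;
    by apply/rowP=> j; rewrite !mxE.
move=> w; apply/rowP=> j; rewrite !mxE /= !r2vK !mxE.
by case: (w 0 j).
Qed.

HB.instance Definition _ (V : vectType R) :=
  Lmodule_hasFinDim.Build R[i] (cplx V) (cplx_vect_iso V).

Definition cplx_map (V W : lmodType R) (f : V -> W) (v : cplx V) : cplx W :=
  (f v.1, f v.2).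

(* Complex-bilinear extension. *)
Definition cplx_map2 (V W Z : lmodType R) (f : V -> W -> Z)
    (v : cplx V) (w : cplx W) : cplx Z :=
  (f v.1 w.1 - f v.2 w.2, f v.1 w.2 + f v.2 w.1).

End Complexification.

Section LieAlgebra.
Variables (F : fieldType) (L : vectType F) (br : L -> L -> L).

(* Bilinearity is not part of these predicates: they are meant for maps of type
   {bilinear L -> L -> L} and {bilinear L -> M -> M}. *)
Definition lie_bracket : Prop :=
  (forall x, br x x = 0) /\
  (forall x y z, br x (br y z) + br y (br z x) + br z (br x y) = 0).

Definition lie_action (M : vectType F) (act : L -> M -> M) : Prop :=
  forall x y m, act (br x y) m = act x (act y m) - act y (act x m).

Definition subalgebra (W : {vspace L}) : Prop :=
  forall x y, x \in W -> y \in W -> br x y \in W.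

Definition abelian_subalgebra (W : {vspace L}) : Prop :=
  forall x y, x \in W -> y \in W -> br x y = 0.

Definition maximal_abelian_subalgebra (W : {vspace L}) : Prop :=
  abelian_subalgebra W /\
  forall W' : {vspace L}, abelian_subalgebra W' -> (W <= W')%VS -> W' = W.

Definition center_of (W : {vspace L}) : set L :=
  [set x | x \in W /\ forall y, y \in W -> br x y = 0].

Definition endo_trace (f : L -> L) : F :=
  \sum_(j < \dim {:L}) coord (vbasis {:L}) j (f (vbasis {:L})`_j).

Definition killing (x y : L) : F := endo_trace (fun z => br x (br y z)).

End LieAlgebra.

Definition set_basis (F : fieldType) (V : vectType F) (P : set V)
    (s : seq V) : Prop :=
  free s /\ forall x, x \in <<s>>%VS <-> P x.

Definition set_dim (F : fieldType) (V : vectType F) (P : set V)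
    (d : nat) : Prop :=
  exists2 W : {vspace V}, (forall x, x \in W <-> P x) & \dim W = d.

Definition Qspan (R : realType) (V : lmodType R) (s : seq V) : set V :=
  [set x | exists c : 'I_(size s) -> rat,
             x = \sum_(j < size s) ratr (c j) *: s`_j].

Definition compact_semisimple (R : realType) (g : vectType R)
    (br : g -> g -> g) : Prop :=
  forall x, x != 0 -> killing br x x < 0.

Section Weights.
Variables (R : realType) (g : vectType R) (h : {vspace g}).

Definition cartan : vectType R[i] := cplx (subvs_of h).

Definition dual_cartan : vectType R[i] := 'Hom(cartan, R[i]^o).

Definition cartan_incl : cartan -> cplx g := cplx_map vsval.

Section WeightSpaces.
Variables (M : vectType R) (act : g -> M -> M).
Implicit Type mu : dual_cartan.

Definition weight_space mu : set (cplx M) :=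
  [set v | forall H : cartan, cplx_map2 act (cartan_incl H) v = mu H *: v].

Definition nonzero_weight mu : Prop :=
  mu != 0 /\ exists2 v, v != 0 & weight_space mu v.

Definition real_weight_space mu : set M :=
  [set u | exists v w, [/\ weight_space mu v, weight_space (- mu) w
                         & cplx_of u = v + w]].

Definition real_zero_weight_space : set M :=
  [set u | weight_space 0 (cplx_of u)].

End WeightSpaces.

Variable br : g -> g -> g.
Implicit Types (Phi Delta : seq dual_cartan).

Definition root_enum Phi : Prop :=
  uniq Phi /\ forall a, a \in Phi <-> nonzero_weight br a.

Definition nat_comb Delta (b : dual_cartan) : Prop :=
  exists c : 'I_(size Delta) -> nat, b = \sum_(j < size Delta) Delta`_j *+ c j.

Definition root_base Phi Delta : Prop :=
  [/\ {subset Delta <= Phi}, free Delta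
    & forall b, b \in Phi -> nat_comb Delta b \/ nat_comb Delta (- b)].

Definition positive_roots Phi Delta : seq dual_cartan :=
  [seq b <- Phi | `[< nat_comb Delta b >]].

Definition cartan_killing (H H' : cartan) : R[i] :=
  killing (cplx_map2 br) (cartan_incl H) (cartan_incl H').

Definition root_vectors Phi (Hr : dual_cartan -> cartan) : Prop :=
  forall a, a \in Phi -> forall H, cartan_killing H (Hr a) = a H.

Definition coroot (Hr : dual_cartan -> cartan) (a : dual_cartan) : cartan :=
  (2 / cartan_killing (Hr a) (Hr a)) *: Hr a.

(* The elements of C0 are those of g whose images in [cplx g] are listed in
   [chevalley_real]. *)
Record compact_chevalley_basis Phi Delta (Hr : dual_cartan -> cartan)
    (X : dual_cartan -> cplx g) (C0 : seq g) : Prop := {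
  chevalley_root : forall b, b \in Phi -> weight_space br b (X b);
  chevalley_basis :
    basis_of {:cplx g} ([seq cartan_incl (coroot Hr a) | a <- Delta]
                          ++ [seq X b | b <- Phi]);
  chevalley_opp : forall a, a \in Phi ->
    cplx_map2 br (X a) (X (- a)) = cartan_incl (coroot Hr a);
  chevalley_struct : exists C : dual_cartan -> dual_cartan -> R[i],
    forall a b, a \in Phi -> b \in Phi -> a + b \in Phi ->
      cplx_map2 br (X a) (X b) = C a b *: X (a + b) /\
      C a b = - C (- a) (- b);
  chevalley_real :
    [seq cplx_of x | x <- C0] =
      [seq 'i *: cartan_incl (coroot Hr a) | a <- Delta]
      ++ [seq X b - X (- b) | b <- positive_roots Phi Delta]
      ++ [seq 'i *: X b + 'i *: X (- b) | b <- positive_roots Phi Delta];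
  chevalley_real_basis : basis_of {:g} C0 }.

(* Since U_mu = U_(-mu), BB mu and BB (-mu) are then equal as sets. *)
Record adapted_basis (U : vectType R) (act : g -> U -> U) (C0 : seq g)
    (B0 BBzero : seq U) (BB : dual_cartan -> seq U) : Prop := {
  adapted_basisT : basis_of {:U} B0;
  adapted_invariant : forall z u, z \in C0 ->
    Qspan B0 u -> Qspan B0 (act z u);
  adapted_zero : set_basis (real_zero_weight_space act) BBzero;
  adapted_weight : forall mu, nonzero_weight act mu ->
    set_basis (real_weight_space act mu) (BB mu);
  adapted_union : forall u, u \in B0 <->
    (u \in BBzero \/ exists2 mu, nonzero_weight act mu & u \in BB mu) }.

End Weights.

Section Nilpotent.
Variables (R : realType) (U g : vectType R).
Local Notation n := (U * g)%type.

Definition chevalley_seq (B0 : seq U) (C0 : seq g) : seq n :=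
  [seq (u, 0) | u <- B0] ++ [seq (0, z) | z <- C0].

Definition inner_product (V : vectType R) (ip : V -> V -> R) : Prop :=
  (forall x y, ip x y = ip y x) /\ (forall x, x != 0 -> 0 < ip x x).

Record adapted_metric (br : g -> g -> g) (act : g -> U -> U)
    (B0 : seq U) (C0 : seq g) (ip : n -> n -> R) : Prop := {
  metric_inner : inner_product ip;
  metric_orth : forall (u : U) (z : g), ip (u, 0) (0, z) = 0;
  metric_skew : forall (z : g) (u u' : U),
    ip (act z u, 0) (u', 0) = - ip (u, 0) (act z u', 0);
  metric_killing : forall z z' : g, ip (0, z) (0, z') = - killing br z z';
  metric_rational : forall x y, x \in chevalley_seq B0 C0 ->
    y \in chevalley_seq B0 C0 -> exists q : rat, ip x y = ratr q }.

Record nilpotent_bracket (act : g -> U -> U) (ip : n -> n -> R)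
    (brn : n -> n -> n) : Prop := {
  nilpotent_lie : lie_bracket brn;
  nilpotent_central : forall (z : g) (x : n), brn (0, z) x = 0;
  nilpotent_range : forall x y, (brn x y).1 = 0;
  nilpotent_def : forall (u u' : U) (z : g),
    ip (brn (u, 0) (u', 0)) (0, z) = ip (act z u, 0) (u', 0) }.

(* Levi-Civita connection of the left invariant metric, on left invariant
   fields: inner products of such fields are constant, so compatibility with
   the metric says that [nabla x] is skew. *)
Definition levi_civita (V : vectType R) (ip : V -> V -> R)
    (brV nabla : V -> V -> V) : Prop :=
  (forall x y z, ip (nabla x y) z + ip y (nabla x z) = 0) /\
  (forall x y, nabla x y - nabla y x = brV x y).

(* nabla exists and is uniquely determined by [levi_civita]; for the subgroup
   exp(W) to be a totally geodesic submanifold means that nabla preserves W. *)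
Definition totally_geodesic (V : vectType R) (ip : V -> V -> R)
    (brV : V -> V -> V) (W : {vspace V}) : Prop :=
  exists2 nabla : {bilinear V -> V -> V}, levi_civita ip brV nabla
    & forall x y, x \in W -> y \in W -> nabla x y \in W.

Definition rational_subspace (V : vectType R) (s : seq V) (W : {vspace V})
    : Prop :=
  exists2 b : seq V, basis_of W b & forall x, x \in b -> Qspan s x.

Definition weight_dual_vector (h : {vspace g}) (ip : n -> n -> R)
    (lambda : dual_cartan h) (Ht : subvs_of h) : Prop :=
  forall H : subvs_of h,
    (ip (0, vsval H) (0, vsval Ht))%:C = - ('i * lambda (cplx_of H)).

Definition n0_sub (h : {vspace g}) (act : g -> U -> U) (u : U)
    (Ht : subvs_of h) : {vspace n} :=
  <<[:: (u, 0); (act (vsval Ht) u, 0); (0, vsval Ht)]%R>>%VS.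

End Nilpotent.

(* Main.v *)
Require Import Defs.
From HB Require Import structures.
From mathcomp Require Import all_boot all_order all_algebra.
From mathcomp Require Import complex.
From mathcomp Require Import boolp classical_sets reals.
From mathcomp Require Import ring lra.

Set Implicit Arguments.
Unset Strict Implicit.
Unset Printing Implicit Defensive.

Import Order.TTheory GRing.Theory Num.Theory.

Local Open Scope ring_scope.

(** Write l(H) = <H, Ht> for H in h, so that lambda(H) = i l(H). Splitting a
    real weight vector u into its lambda and -lambda parts yields a second
    vector J with H(u) = l(H) J and H(J) = - l(H) u for all H in h: the torus
    acts on the plane spanned by u and J by infinitesimal rotations
    ([real_weight_plane]).

    Infinitesimal rotations of a plane kill its area form, and [u, J] depends
    on u and J only through that form. Hence [u, J] commutes with h, and lies
    in h because h is maximal abelian. The equation <[u, J], H> = <H(u), J> on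
    h then determines it: [u, J] = <u, u> Ht ([plane_bracket]). This uses that
    the bracket of n is equivariant, which is the invariance of the Killing
    form ([killing_invariant]). As l(Ht) = <Ht, Ht> is nonzero, the subspace
    in question is the span of u, J and Ht, a Heisenberg algebra with center
    spanned by Ht. It is totally geodesic because the Levi-Civita connection
    of n is built from the bracket of n and the action of g on U
    ([two_step_levi_civita]), and Ht rotates the plane of u and J.

    For rationality, the coroots of the simple roots span the complexified
    Cartan subalgebra ([cartan_span_coroots]), so some T in C0 that lies in h
    has l(T) nonzero.
    If u is rational, then so is T(u) = l(T) J, because C0 preserves the
    rational span of B0; and so is [u, T(u)], because its inner products with
    the elements of C0 are rational and the Gram matrix of C0 is an invertible
    rational matrix ([Qspan_brn]). These three vectors span the subalgebra. *)

(** * Trace forms and invariance of the Killing form *)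

(** In the chosen basis both traces are the same double sum of products of
    matrix coefficients. *)
Lemma endo_trace_mulC (F : fieldType) (L : vectType F) (f f' : {linear L -> L}) :
  endo_trace (f \o f') = endo_trace (f' \o f).
Proof.
have expand (p q : {linear L -> L}) : endo_trace (p \o q) =
    \sum_(j < \dim {:L}) \sum_(k < \dim {:L})
      coord (vbasis {:L}) k (q (vbasis {:L})`_j)
      * coord (vbasis {:L}) j (p (vbasis {:L})`_k).
  apply: eq_bigr => j _ /=.
  rewrite {1}(coord_vbasis (memvf (q (vbasis {:L})`_j))) !linear_sum /=.
  by apply: eq_bigr => k _; rewrite !linearZ.
rewrite !expand exchange_big /=.
by apply: eq_bigr => k _; apply: eq_bigr => j _; rewrite mulrC.
Qed.

Lemma endo_traceB (F : fieldType) (L : vectType F) (f f' : L -> L) :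
  endo_trace (fun x => f x - f' x) = endo_trace f - endo_trace f'.
Proof. by rewrite -sumrB; apply: eq_bigr => j _; rewrite linearB. Qed.

Section LieBracket.
Variables (F : fieldType) (L : vectType F) (br : {bilinear L -> L -> L}).
Hypothesis Hbr : lie_bracket br.

Lemma bracketNC x y : br x y = - br y x.
Proof.
apply/eqP; rewrite -addr_eq0; apply/eqP.
have := Hbr.1 (x + y).
by rewrite linearDl !linearDr /= !Hbr.1 add0r addr0.
Qed.

Lemma bracket_adjoint x y z : br (br x y) z = br x (br y z) - br y (br x z).
Proof.
have := Hbr.2 x y z; rewrite (bracketNC z (br x y)) (bracketNC z x) linearNr /=.
by move/eqP; rewrite subr_eq0 => /eqP <-.
Qed.

(** Writing ad [x, y] as a commutator turns both sides into differences of
    traces of products of three operators, equal up to a cyclic rotation. *)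
Lemma killing_invariant x y z :
  killing br (br x y) z = - killing br y (br x z).
Proof.
pose a w : {linear L -> L} := br w.
have E1 : killing br (br x y) z =
    endo_trace (a x \o (a y \o a z)) - endo_trace (a y \o (a x \o a z)).
  by rewrite -endo_traceB; apply: eq_bigr => j _; rewrite bracket_adjoint.
have E2 : killing br y (br x z) =
    endo_trace (a y \o (a x \o a z)) - endo_trace ((a y \o a z) \o a x).
  by rewrite -endo_traceB; apply: eq_bigr => j _; rewrite bracket_adjoint linearBr.
by rewrite E1 E2 endo_trace_mulC opprB.
Qed.

End LieBracket.

(** Adjoining such an x to h keeps the subalgebra abelian. *)
Lemma mem_maximal_abelian (F : fieldType) (L : vectType F)
    (br : {bilinear L -> L -> L}) (h : {vspace L}) (x : L) :
  lie_bracket br -> maximal_abelian_subalgebra br h ->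
  (forall y, y \in h -> br y x = 0) -> x \in h.
Proof.
move=> Hbr [abh maxh] xh.
suff <- : (h + <[x]>)%VS = h by exact: (subvP (addvSr _ _) _ (memv_line x)).
apply: maxh (addvSl _ _) => p q /memv_addP[y hy [s /vlineP[c ->] ->]].
move=> /memv_addP[y' hy' [s' /vlineP[c' ->] ->]].
rewrite linearDl !linearDr /= !linearZl_LR !linearZr_LR /= abh // Hbr.1.
by rewrite xh // (bracketNC Hbr x) xh // oppr0 !scaler0 !addr0.
Qed.

(** * Rational spans *)

Section Qspan.
Variables (R : realType) (V : lmodType R).
Implicit Type s : seq V.

Lemma mem_Qspan s x : x \in s -> Qspan s x.
Proof.
move=> xs; have xs' := xs; rewrite -index_mem in xs'.
exists (fun j => (j == Ordinal xs')%:R).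
rewrite (bigD1 (Ordinal xs')) //= eqxx rmorph1 scale1r nth_index // big1 ?addr0 //.
by move=> j /negPf ->; rewrite rmorph0 scale0r.
Qed.

Lemma Qspan0 s : Qspan s 0.
Proof. by exists (fun=> 0); rewrite big1 // => j _; rewrite rmorph0 scale0r. Qed.

Lemma QspanPD s (q : rat) x y : Qspan s x -> Qspan s y -> Qspan s (ratr q *: x + y).
Proof.
move=> [c ->] [d ->]; exists (fun j => q * c j + d j).
rewrite scaler_sumr -big_split /=; apply: eq_bigr => j _.
by rewrite rmorphD rmorphM /= scalerDl scalerA.
Qed.

End Qspan.

Lemma Qspan_linear (R : realType) (V W : lmodType R) (f : V -> W)
    (s : seq V) (t : seq W) x :
  linear f -> (forall y, y \in s -> Qspan t (f y)) -> Qspan s x -> Qspan t (f x).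
Proof.
move=> flin fs [c ->].
pose f' := HB.pack_for {linear V -> W} f (GRing.isLinear.Build R V W *:%R f flin).
rewrite -[f]/(f' : V -> W) linear_sum.
elim/big_ind : _ => [|y z Hy Hz|j _]; first exact: Qspan0.
  by have := QspanPD 1 Hy Hz; rewrite rmorph1 scale1r.
rewrite linearZ /= -[_ *: _]addr0; apply: QspanPD (Qspan0 _).
by apply/fs/mem_nth.
Qed.

(** Rational scalars as the rational span of 1, so that closure properties of
    rational spans also serve for rational-valued forms. *)
Lemma Qspan1P (R : realType) (r : R) :
  Qspan [:: 1 : R^o] r <-> exists q : rat, r = ratr q.
Proof.
split=> [[c ->]|[q ->]].
  by exists (c ord0); rewrite big_ord_recl big_ord0 addr0 /= [LHS]mulr1.
by exists (fun=> q); rewrite big_ord_recl big_ord0 addr0 /= [RHS]mulr1.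
Qed.

(** The coordinates of x on s solve a linear system with rational right-hand
    side, whose matrix is the Gram matrix of s. That matrix is invertible over
    the rationals: a rational kernel vector gives a combination of s of norm
    zero. *)
Lemma Qspan_rational_form (R : realType) (V : vectType R)
    (ip : {bilinear V -> V -> R | *%R & *%R}) (s : seq V) (x : V) :
  (forall y, ip y y = 0 -> y = 0) -> free s -> x \in <<s>>%VS ->
  (forall y z, y \in s -> z \in s -> exists q : rat, ip y z = ratr q) ->
  (forall y, y \in s -> exists q : rat, ip x y = ratr q) -> Qspan s x.
Proof.
move=> ip0 sfree xs ips ipx.
pose n := size s; pose X : n.-tuple V := in_tuple s.
have memX (i : 'I_n) : s`_i \in s by exact: mem_nth.
have [G GE] := fin_all_exists (fun ij : 'I_n * 'I_n => ips _ _ (memX ij.1) (memX ij.2)).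
have [r rE] := fin_all_exists (fun i => ipx _ (memX i)).
pose Gm : 'M[rat]_n := \matrix_(i, j) G (i, j).
pose comb (a : 'rV[R]_n) := \sum_i a 0 i *: s`_i.
have ip_comb a : \row_j ip (comb a) s`_j = a *m map_mx ratr Gm.
  apply/rowP=> j; rewrite !mxE linear_sumlz; apply: eq_bigr => i _.
  by rewrite linearZl_LR /= (GE (i, j)) !mxE.
have Gunit : Gm \in unitmx.
  rewrite -row_free_unit -kermx_eq0; apply/eqP/row_matrixP => i; rewrite row0.
  set v := row i _; pose a : 'rV[R]_n := map_mx ratr v.
  have vG : v *m Gm = 0 by apply/sub_kermxP/row_sub.
  have /ip0 y0 : ip (comb a) (comb a) = 0.
    rewrite {2}/comb linear_sumr big1 // => j _; rewrite linearZr_LR /=.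
    have /rowP/(_ j) := ip_comb a.
    by rewrite -map_mxM vG map_mx0 !mxE => ->; rewrite mulr0.
  apply/rowP=> j; have /freeP/(_ (fun j => a 0 j) y0 j) := (sfree : free X).
  by rewrite !mxE => /eqP; rewrite fmorph_eq0 => /eqP.
pose a : 'rV[R]_n := \row_i coord X i x.
have xE : x = comb a.
  by rewrite [LHS](coord_span (X := X) xs); apply: eq_bigr => i _; rewrite mxE.
have aE : a = map_mx ratr (\row_i r i *m invmx Gm).
  rewrite map_mxM map_invmx.
  have -> : map_mx ratr (\row_i r i) = \row_j ip (comb a) s`_j.
    by apply/rowP=> j; rewrite !mxE -xE rE.
  by rewrite ip_comb mulmxK // map_unitmx.
exists (fun i => (\row_i r i *m invmx Gm) 0 i).
by rewrite {1}xE; apply: eq_bigr => i _; rewrite {1}aE [in LHS]mxE.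
Qed.

(** * Weights, coroots and the real plane of a weight vector *)

Section Weights.
Variables (R : realType) (g : vectType R) (h : {vspace g}).

Lemma cartan_decomp (z : cartan h) :
  z = cplx_of z.1 + ('i%C : R[i]) *: cplx_of z.2.
Proof.
by case: z => x y; congr (_, _);
  rewrite /= !(scale0r, scale1r, scaler0, subr0, addr0, add0r).
Qed.

(** A complex-linear form on the complexification of h is determined by its
    values on the real points. *)
Lemma dual_cartan_eq0 (l : dual_cartan h) :
  (forall H, l (cplx_of H) = 0) -> l = 0.
Proof.
move=> l0; apply/lfunP=> z.
by rewrite (cartan_decomp z) linearD linearZ /= !l0 scaler0 addr0 zero_lfunE.
Qed.

(** Write u = v + w with v of weight lambda and w of weight - lambda. A real H
    maps u to l(H) times i (v - w), and i (v - w) to - l(H) u; it preserves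
    real parts, so the real part of i (v - w) serves as J. *)
Lemma real_weight_plane (U : vectType R) (act : {bilinear g -> U -> U})
    (lambda : dual_cartan h) (l : subvs_of h -> R) u :
  (forall H, lambda (cplx_of H) = Complex 0 (l H)) ->
  real_weight_space act lambda u ->
  exists J, forall H, act (vsval H) u = l H *: J /\
                      act (vsval H) J = - (l H *: u).
Proof.
move=> lE [v [w [Hv Hw /eqP]]]; rewrite /cplx_of xpair_eqE /= => /andP[/eqP uE /eqP vw0].
exists (w.2 - v.2) => H.
have := Hv (cplx_of H); have := Hw (cplx_of H).
rewrite /cplx_map2 /cartan_incl /cplx_map /cplx_of lfunE /= lE /=.
move=> /pair_equal_spec[/= w1 w2] /pair_equal_spec[/= v1 v2].
move: w1 w2 v1 v2.
rewrite !linear0l !subr0 !addr0 !oppr0 !scale0r !add0r.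
move=> w1 w2 v1 v2; split.
  by rewrite uE linearDr /= v1 w1 scaleNr opprK scalerBr addrC.
by rewrite linearBr /= v2 w2 uE scaleNr scalerDr opprD addrC.
Qed.

Lemma cplx_map2_linear (U V W : vectType R) (f : {bilinear U -> V -> W}) x :
  linear (cplx_map2 f x).
Proof.
move=> [a b] [p q] [p' q']; congr (_, _) => /=;
  rewrite !linearDr /= !linearNr !linearZr_LR /= !(scalerBr, scalerDr) ?opprD
    addrACA; congr (_ + _).
  by rewrite -opprD addrACA opprD.
by rewrite addrACA.
Qed.

Lemma cartan_incl_linear : linear (@cartan_incl R g h).
Proof.
by move=> [a b] [p q] [p' q']; congr (_, _);
  rewrite /= !linearD /= ?linearN !linearZ.
Qed.

Lemma cartan_incl_inj : injective (@cartan_incl R g h).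
Proof. by move=> [p q] [p' q'] [/val_inj -> /val_inj ->]. Qed.

Variable br : {bilinear g -> g -> g}.

(** Expand H in the Chevalley basis. The part z in the span of the X b differs
    from H by a combination of coroots, so it commutes with h; since each b is
    nonzero on h and the X b are free, all coordinates of z vanish. *)
Lemma cartan_span_coroots (Phi Delta : seq (dual_cartan h)) Hr X C0 (H : cartan h) :
  abelian_subalgebra br h -> root_enum br Phi ->
  compact_chevalley_basis br Phi Delta Hr X C0 ->
  H \in <<[seq coroot br Hr a | a <- Delta]>>%VS.
Proof.
move=> abh HPhi HC.
pose incl : {linear cartan h -> cplx g} := HB.pack_for {linear cartan h -> cplx g}
  (@cartan_incl R g h) (GRing.isLinear.Build _ _ _ *:%R _ cartan_incl_linear).
have basis := chevalley_basis HC.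
have : cartan_incl H \in {:cplx g}%VS by exact: memvf.
rewrite -(span_basis basis) span_cat => /memv_addP[y].
have -> : [seq cartan_incl (coroot br Hr a) | a <- Delta] =
    [seq linfun incl H | H <- [seq coroot br Hr a | a <- Delta]].
  by rewrite -map_comp; apply: eq_map => a /=; symmetry; exact: (lfunE incl).
rewrite -limg_span => /memv_imgP[K KD ->] [z zX]; rewrite lfunE /= => HE.
have zE : z = incl (H - K) by rewrite linearB /= HE addrC addKr.
suff z0 : z = 0.
  suff -> : H = K by [].
  by apply: cartan_incl_inj; rewrite HE z0 addr0.
pose XX := [seq X b | b <- Phi].
have sX : size XX = size Phi by rewrite size_map.
have Xfree : free XX by exact: catr_free (basis_free basis).
have zsum := coord_span (X := in_tuple XX) zX.
rewrite zsum big1 // => j _; set d := coord _ _ _.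
have jPhi : (j < size Phi)%N by rewrite -sX.
pose b := Phi`_j; have bPhi : b \in Phi by exact: mem_nth.
have [b0 _] := (HPhi.2 b).1 bPhi.
suff -> : d = 0 by rewrite scale0r.
apply/eqP; apply: contraNT b0 => d0; apply/eqP/lfunP => H'; rewrite zero_lfunE.
pose adH : {linear cplx g -> cplx g} := HB.pack_for {linear cplx g -> cplx g}
  (cplx_map2 br (cartan_incl H'))
  (GRing.isLinear.Build _ _ _ *:%R _ (cplx_map2_linear br (cartan_incl H'))).
have adz : adH z = 0.
  rewrite zE; case: (H - K) => k1 k2; case: H' @adH => h1 h2 /=.
  by rewrite /cplx_map2 /= !abh ?subvsP // subr0 addr0.
have := adz; rewrite zsum linear_sum /=.
have -> : \sum_(i < size XX) adH (coord (in_tuple XX) i z *: XX`_i) =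
   \sum_(i < size XX) (coord (in_tuple XX) i z * Phi`_i H') *: XX`_i.
  apply: eq_bigr => i _; rewrite linearZ /= -scalerA; congr (_ *: _).
  have iPhi : (i < size Phi)%N by rewrite -sX.
  by rewrite (nth_map 0) //; apply: (chevalley_root HC) => //; exact: mem_nth.
move=> sum0.
have /freeP/(_ _ sum0 j)/eqP := (Xfree : free (in_tuple XX)).
by rewrite mulf_eq0 (negPf d0) => /eqP.
Qed.

(** i times a coroot is purely real, being the image of an element of C0. *)
Lemma chevalley_torus_mem (Phi Delta : seq (dual_cartan h)) Hr X C0 a :
  compact_chevalley_basis br Phi Delta Hr X C0 -> a \in Delta ->
  exists2 T : subvs_of h, vsval T \in C0 &
    cplx_of T = ('i%C : R[i]) *: coroot br Hr a.
Proof.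
move=> HC aD.
have : ('i%C : R[i]) *: cartan_incl (coroot br Hr a) \in [seq cplx_of x | x <- C0].
  rewrite (chevalley_real HC) mem_cat; apply/orP; left.
  by apply/mapP; exists a.
case/mapP=> c cC0.
case: (coroot br Hr a) => p q /pair_equal_spec[/= cE pE].
rewrite !scale0r !scale1r ?sub0r ?add0r in cE pE.
exists (- q); first by rewrite linearN /= cE.
have -> : p = 0 by apply: val_inj; rewrite /= pE.
by congr (_, _); rewrite /= !(scale0r, scale1r, scaler0, sub0r, addr0, add0r).
Qed.

(** Otherwise lambda would vanish on the coroots of the base, which span. *)
Lemma exists_chevalley_torus (Phi Delta : seq (dual_cartan h)) Hr X C0
    (lambda : dual_cartan h) :
  abelian_subalgebra br h -> root_enum br Phi ->
  compact_chevalley_basis br Phi Delta Hr X C0 -> lambda != 0 ->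
  exists2 T : subvs_of h, vsval T \in C0 & lambda (cplx_of T) != 0.
Proof.
move=> abh HPhi HC; case: (pselect (exists2 a, a \in Delta & lambda (coroot br Hr a) != 0)).
  move=> [a aD la] _; have [T TC TE] := chevalley_torus_mem HC aD; exists T => //.
  by rewrite TE linearZ /= mulf_neq0 // eq_complex /= oner_eq0 andbF.
move=> no; case/eqP; apply/lfunP => H; rewrite zero_lfunE; apply/eqP.
suff /subvP/(_ H (cartan_span_coroots H abh HPhi HC)) :
    (<<[seq coroot br Hr a | a <- Delta]>> <= lker lambda)%VS by rewrite memv_ker.
apply/span_subvP => _ /mapP[a aD ->]; rewrite memv_ker.
by apply: contra_notT no => la; exists a.
Qed.

End Weights.

(** * Two-step nilpotent metric Lie algebras *)

Section Pairs.
Variables (R : realType) (U g : vectType R).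

Lemma pair_split (u : U) (z : g) : (u, z) = (u, 0) + (0, z).
Proof. by congr (_, _); rewrite /= ?addr0 ?add0r. Qed.

Lemma pairlD (u v : U) : (u + v, 0 : g) = (u, 0) + (v, 0).
Proof. by congr (_, _); rewrite /= addr0. Qed.

Lemma pairlZ a (u : U) : (a *: u, 0 : g) = a *: (u, 0 : g).
Proof. by congr (_, _); rewrite /= scaler0. Qed.

Lemma pairlN (u : U) : (- u, 0 : g) = - (u, 0 : g).
Proof. by congr (_, _); rewrite /= oppr0. Qed.

Lemma pairrD (z t : g) : (0 : U, z + t) = (0, z) + (0, t).
Proof. by congr (_, _); rewrite /= addr0. Qed.

Lemma pairrZ a (z : g) : (0 : U, a *: z) = a *: (0 : U, z).
Proof. by congr (_, _); rewrite /= scaler0. Qed.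

Lemma pairrN (z : g) : (0 : U, - z) = - (0 : U, z).
Proof. by congr (_, _); rewrite /= oppr0. Qed.

End Pairs.

Section Connection.
Variables (R : realType) (g U : vectType R).
Local Notation n := (U * g)%type.
Variables (act : {bilinear g -> U -> U}) (brn : {bilinear n -> n -> n}).

(** Koszul's formula for a two-step nilpotent algebra: nabla_u u' = [u, u']/2,
    nabla_u z = nabla_z u = - z(u)/2 and nabla_z z' = 0. *)
Definition two_step_connection (x y : n) : n :=
  (- (2^-1 *: (act x.2 y.1 + act y.2 x.1)),
   2^-1 *: (brn (x.1, 0) (y.1, 0)).2).

Fact two_step_connection_bilinear :
  bilinear_for *:%R *:%R two_step_connection.
Proof.
split=> [y|x] a p q; congr (_, _) => /=.
- rewrite linearPl linearPr addrACA -scalerDr.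
  set s := (act _ _ + act _ _).
  by rewrite scalerDr opprD scalerN !scalerA mulrC.
- by rewrite (pairlD g (a *: _)) pairlZ linearPl /= scalerDr !scalerA mulrC.
- rewrite linearPl linearPr addrACA -scalerDr.
  set s := (act _ _ + act _ _).
  by rewrite scalerDr opprD scalerN !scalerA mulrC.
- by rewrite (pairlD g (a *: _)) pairlZ linearPr /= scalerDr !scalerA mulrC.
Qed.

HB.instance Definition _ := bilinear_isBilinear.Build R n n n *:%R *:%R
  two_step_connection two_step_connection_bilinear.

End Connection.

Section Metric.
Variables (R : realType) (g U : vectType R).
Local Notation n := (U * g)%type.
Variables (br : {bilinear g -> g -> g}) (act : {bilinear g -> U -> U}).
Variables (B0 : seq U) (C0 : seq g).
Variables (ip : {bilinear n -> n -> R | *%R & *%R}).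
Variables (brn : {bilinear n -> n -> n}).
Hypotheses (Hbr : lie_bracket br) (Hact : lie_action br act).
Hypotheses (Hip : adapted_metric br act B0 C0 ip).
Hypothesis Hbrn : nilpotent_bracket act ip brn.

Let ipC := (metric_inner Hip).1.

Lemma ip_eq0 x : ip x x = 0 -> x = 0.
Proof.
move=> xx; apply/eqP; apply: contraT => /(metric_inner Hip).2.
by rewrite xx ltxx.
Qed.

Lemma ip_pair u a v b : ip (u, a) (v, b) = ip (u, 0) (v, 0) + ip (0, a) (0, b).
Proof.
rewrite (pair_split u a) (pair_split v b) linearDl !linearDr /=.
by rewrite (metric_orth Hip) (ipC (0, a)) (metric_orth Hip) addr0 add0r.
Qed.

Lemma act_orth z u : ip (act z u, 0) (u, 0) = 0.
Proof. by have := metric_skew Hip z u u; rewrite (ipC (u, 0)); lra. Qed.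

Lemma brn_pair u a v b : brn (u, a) (v, b) = (0, (brn (u, 0) (v, 0)).2).
Proof.
have brz x z : brn x (0, z) = 0.
  by rewrite (bracketNC (nilpotent_lie Hbrn)) (nilpotent_central Hbrn) oppr0.
rewrite (pair_split u a) (pair_split v b) linearDl !linearDr /=.
rewrite !brz !(nilpotent_central Hbrn) !addr0.
by rewrite -(nilpotent_range Hbrn (u, 0) (v, 0)) -surjective_pairing.
Qed.

Lemma ip_brn u v z : ip (0, (brn (u, 0) (v, 0)).2) (0, z) = ip (act z u, 0) (v, 0).
Proof. by rewrite -(nilpotent_def Hbrn) (brn_pair u 0 v 0). Qed.

Lemma brnNC2 u v : (brn (u, 0) (v, 0)).2 = - (brn (v, 0) (u, 0)).2.
Proof. by rewrite (bracketNC (nilpotent_lie Hbrn)). Qed.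

Lemma two_step_levi_civita : levi_civita ip brn (two_step_connection act brn).
Proof.
split=> [[u a] [v b] [w c]|[u a] [v b]].
  rewrite /two_step_connection /= (ip_pair _ _ w c) (ip_pair v b).
  rewrite !pairlN !pairlZ !pairlD !pairrZ.
  rewrite !linearNl /= !linearNr !linearZl_LR !linearZr_LR /= !linearDl !linearDr /=.
  rewrite ip_brn (ipC (0, b)) ip_brn.
  have := metric_skew Hip a v w; have := metric_skew Hip c u v.
  have := ipC (v, 0) (act c u, 0).
  have := metric_skew Hip b u w.
  lra.
rewrite brn_pair /two_step_connection; congr (_, _) => /=.
  by rewrite [X in _ - - (_ *: X)]addrC subrr.
by rewrite (brnNC2 v u) scalerN opprK -scalerDl -[2^-1]mul1r -splitr scale1r.
Qed.

Section Plane.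
Variables (h : {vspace g}) (Hh : maximal_abelian_subalgebra br h).
Variables (l : subvs_of h -> R) (u J : U).
Hypothesis HuJ : forall H, act (vsval H) u = l H *: J /\
                           act (vsval H) J = - (l H *: u).

(** By invariance of the Killing form, <[y, x], t> for x = [u, J] is the sum of
    <t(y u), J> and <t(u), y J>. With y u a multiple of J and y J a
    multiple of u, both terms vanish by skewness of t. *)
Lemma plane_bracket_commutes y : y \in h -> br y (brn (u, 0) (J, 0)).2 = 0.
Proof.
move=> yh; set x := (brn _ _).2.
have [yu yJ] := HuJ (vsproj h y); rewrite vsprojK // in yu yJ.
suff : (0 : U, br y x) = 0 by case.
apply: ip_eq0; set t := br y x.
have -> : ip (0, t) (0, t) = - ip (0, x) (0, br y t).
  by rewrite !(metric_killing Hip) killing_invariant.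
rewrite ip_brn Hact yu pairlD pairlN linearDl linearNl /=.
rewrite (metric_skew Hip y) yJ linearZr_LR /= pairlN pairlZ linearNr linearZr_LR /=.
by rewrite pairlZ linearZl_LR /= !act_orth; ring.
Qed.

Variable Ht : subvs_of h.
Hypothesis lE : forall H, l H = ip (0, vsval H) (0, vsval Ht).
Hypotheses (lHt : l Ht != 0) (u0 : u != 0).

Let N := ip (u, 0) (u, 0).

Lemma plane_norm_neq0 : N != 0.
Proof. by apply/eqP=> /ip_eq0 [/eqP]; rewrite (negPf u0). Qed.

Lemma plane_orth : ip (u, 0) (J, 0) = 0.
Proof.
have := act_orth (vsval Ht) u.
rewrite (HuJ Ht).1 pairlZ linearZl_LR /= => /eqP.
by rewrite mulf_eq0 (negPf lHt) /= ipC => /eqP.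
Qed.

(** Both sides lie in h and have the same inner products with h, where the
    metric is definite. *)
Lemma plane_bracket : (brn (u, 0) (J, 0)).2 = N *: vsval Ht.
Proof.
set x := (brn _ _).2.
have xh : x \in h by apply: mem_maximal_abelian Hbr Hh plane_bracket_commutes.
have orth y : y \in h -> ip (0, x - N *: vsval Ht) (0, y) = 0.
  move=> yh; have [yu yJ] := HuJ (vsproj h y); have := lE (vsproj h y).
  rewrite vsprojK // in yu yJ *; rewrite pairrD linearDl /= ip_brn.
  rewrite (metric_skew Hip) yJ pairlN pairlZ linearNr linearZr_LR /=.
  by rewrite pairrN pairrZ linearNl linearZl_LR /= (ipC (0, vsval Ht)) => <-; rewrite /N; ring.
have /ip_eq0[/eqP] := orth _ (rpredB xh (rpredZ N (subvsP Ht))).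
by rewrite subr_eq0 => /eqP.
Qed.

(** The freedom in b and c serves the two bases of the subalgebra that matter:
    its defining one and the rational one. *)
Lemma span_planeP b c x : b != 0 -> c != 0 ->
  reflect (exists a, x = (a.1.1 *: u + a.1.2 *: J, a.2 *: vsval Ht))
    (x \in <<[:: (u, 0); (b *: J, 0); (0, c *: vsval Ht)]%R>>%VS).
Proof.
move=> b0 c0; rewrite !span_cons span_nil addv0.
apply: (iffP memv_addP) => [[s1 /vlineP[p ->] [s2 /memv_addP]]|[[[p q] r] -> /=]].
  move=> [s3 /vlineP[q ->] [s4 /vlineP[r ->] ->] ->].
  exists (p, q * b, r * c); rewrite -pairlZ -pairlZ -pairrZ !scalerA.
  by congr (_, _); rewrite /= ?addr0 ?add0r.
exists (p *: (u, 0)); first exact/memvZ/memv_line.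
exists ((q / b) *: (b *: J, 0) + (r / c) *: (0, c *: vsval Ht)).
  by apply: memv_add; exact/memvZ/memv_line.
rewrite -!pairlZ -pairrZ !scalerA !divfK //.
by congr (_, _); rewrite /= ?addr0 ?add0r.
Qed.

Lemma plane_basis b c : b != 0 -> c != 0 ->
  basis_of (n0_sub act u Ht) [:: (u, 0); (b *: J, 0); (0, c *: vsval Ht)].
Proof.
move=> b0 c0; apply/andP; split.
  apply/eqP/vspaceP => x; rewrite /n0_sub (HuJ Ht).1.
  rewrite -{2}[vsval Ht]scale1r.
  by apply/span_planeP/span_planeP => //; exact: oner_neq0.
have J0 : J != 0.
  apply: contraNneq u0 => J0; have [_] := HuJ Ht.
  by rewrite J0 linear0r => /esym/eqP; rewrite oppr_eq0 scaler_eq0 (negPf lHt).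
rewrite !free_cons nil_free !span_cons span_nil !addv0 andbT.
apply/and3P; split.
- apply/negP=> /memv_addP[s1 /vlineP[q ->] [s2 /vlineP[r ->]]].
  rewrite -pairlZ -pairrZ scalerA => -[]; rewrite addr0 => uJ _.
  have /eqP := plane_norm_neq0; apply; rewrite /N {2}uJ pairlZ linearZr_LR /=.
  by rewrite plane_orth mulr0.
- apply/negP=> /vlineP[r]; rewrite -pairrZ => -[/eqP].
  by rewrite scaler_eq0 (negPf b0) (negPf J0).
- rewrite memv0; apply/eqP=> -[/eqP]; rewrite scaler_eq0 (negPf c0) /= => /eqP Ht0.
  by move: lHt; rewrite lE Ht0 linear0r eqxx.
Qed.

Lemma n0_subP x :
  reflect (exists a, x = (a.1.1 *: u + a.1.2 *: J, a.2 *: vsval Ht))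
    (x \in n0_sub act u Ht).
Proof.
rewrite -(span_basis (plane_basis (oner_neq0 R) (oner_neq0 R))).
by apply: span_planeP; exact: oner_neq0.
Qed.

Lemma dim_plane : \dim (n0_sub act u Ht) = 3%N.
Proof. exact: (size_basis (plane_basis (oner_neq0 R) (oner_neq0 R) : basis_of _ (in_tuple _))). Qed.

(** The determinant of the coordinates is the area form of the plane. *)
Lemma plane_brn p q p' q' :
  (brn (p *: u + q *: J, 0) (p' *: u + q' *: J, 0)).2 =
  ((p * q' - q * p') * N) *: vsval Ht.
Proof.
have alt := (nilpotent_lie Hbrn).1.
rewrite !pairlD !pairlZ linearDl !linearDr /= !linearZl_LR !linearZr_LR /= !alt.
rewrite (bracketNC (nilpotent_lie Hbrn) (J, 0)) /= plane_bracket.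
by rewrite !scaler0 !scalerN !scalerA add0r addr0 -scalerBl; congr (_ *: _); ring.
Qed.

Lemma plane_subalgebra : subalgebra brn (n0_sub act u Ht).
Proof.
move=> _ _ /n0_subP[[[p q] r] ->] /n0_subP[[[p' q'] r'] ->] /=.
rewrite brn_pair plane_brn; apply/n0_subP.
by exists (0, 0, (p * q' - q * p') * N); rewrite /= !scale0r addr0.
Qed.

Lemma plane_totally_geodesic : totally_geodesic ip brn (n0_sub act u Ht).
Proof.
exists (two_step_connection act brn : {bilinear n -> n -> n}).
  exact: two_step_levi_civita.
move=> _ _ /n0_subP[[[p q] r] ->] /n0_subP[[[p' q'] r'] ->] /=.
have actE a b c : act (c *: vsval Ht) (a *: u + b *: J) =
    (- (c * b * l Ht)) *: u + (c * a * l Ht) *: J.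
  rewrite linearZl_LR linearDr !linearZr_LR /= (HuJ Ht).1 (HuJ Ht).2.
  by rewrite scalerN scalerDr scalerN !scalerA scaleNr addrC.
rewrite /two_step_connection /= !actE plane_brn; apply/n0_subP.
exists (2^-1 * (r * q' * l Ht + r' * q * l Ht),
        - (2^-1 * (r * p' * l Ht + r' * p * l Ht)),
        2^-1 * ((p * q' - q * p') * N)) => /=; congr (_, _).
  rewrite addrACA -!scalerDl scalerDr !scalerA opprD -!scaleNr.
  by congr (_ *: _ + _ *: _); ring.
by rewrite scalerA.
Qed.

Lemma plane_center : set_dim (center_of brn (n0_sub act u Ht)) 1.
Proof.
exists <[(0, vsval Ht)%R]>%VS; last first.
  rewrite dim_vline; case: eqP => // -[Ht0].
  by move: lHt; rewrite lE Ht0 linear0r eqxx.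
move=> x; split=> [/vlineP[r ->]|[/n0_subP[[[p q] r] -> /=] cx]].
  rewrite -pairrZ; split.
    by apply/n0_subP; exists (0, 0, r); rewrite /= !scale0r addr0.
  by move=> y _; rewrite (nilpotent_central Hbrn).
have eq0 p' q' : p * q' - q * p' = 0.
  have yW : (p' *: u + q' *: J, 0 *: vsval Ht) \in n0_sub act u Ht.
    by apply/n0_subP; exists (p', q', 0).
  have := cx _ yW; rewrite brn_pair plane_brn => -[/eqP].
  rewrite scaler_eq0 mulf_eq0 (negPf plane_norm_neq0) orbF => /orP[/eqP //|/eqP Ht0].
  by move: lHt; rewrite lE Ht0 linear0r eqxx.
have := eq0 0 1; have := eq0 1 0.
rewrite !mulr0 !mulr1 sub0r subr0 => /eqP; rewrite oppr_eq0 => /eqP -> ->.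
by rewrite !scale0r addr0 pairrZ; apply/memvZ/memv_line.
Qed.

Section RationalPlane.
Hypothesis C0basis : basis_of {:g} C0.
Hypothesis B0invariant :
  forall z w, z \in C0 -> Qspan B0 w -> Qspan B0 (act z w).

Lemma Qspan_chevalley_module w :
  Qspan B0 w -> Qspan (chevalley_seq B0 C0) (w, 0).
Proof.
apply: (Qspan_linear (f := fun w => (w, 0) : n)) => [a x y|x xB].
  by rewrite pairlD pairlZ.
by apply: mem_Qspan; rewrite mem_cat map_f.
Qed.

Lemma ip_module_rational v w :
  Qspan B0 v -> Qspan B0 w -> exists q : rat, ip (v, 0) (w, 0) = ratr q.
Proof.
move=> vQ wQ; apply/Qspan1P.
apply: (Qspan_linear (f := fun v => ip (v, 0) (w, 0) : R^o)) vQ => [a x y|x xB].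
  by rewrite pairlD pairlZ linearPl.
apply: (Qspan_linear (f := fun w => ip (x, 0) (w, 0) : R^o)) wQ => [a y z|y yB].
  by rewrite pairlD pairlZ linearPr.
by apply/Qspan1P; apply: (metric_rational Hip); rewrite mem_cat map_f.
Qed.

(** Pairing [v, w] with c in C0 gives the inner product of c(v) with w, both
    in the rational span of B0; so the bracket has rational coordinates. *)
Lemma Qspan_brn v w : Qspan B0 v -> Qspan B0 w ->
  Qspan (chevalley_seq B0 C0) (0, (brn (v, 0) (w, 0)).2).
Proof.
move=> vQ wQ; set b := (brn _ _).2.
have memC x : x \in [seq (0, z) : n | z <- C0] -> x \in chevalley_seq B0 C0.
  by rewrite mem_cat => ->; rewrite orbT.
have inr_linear : linear (fun z : g => (0, z) : n).
  by move=> a y z; rewrite pairrD pairrZ.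
pose inr : {linear g -> n} := HB.pack_for {linear g -> n} (fun z : g => (0, z) : n)
  (GRing.isLinear.Build R g n *:%R _ inr_linear).
have mapE : [seq (0, z) : n | z <- C0] = map (linfun inr) C0.
  by apply: eq_map => z; rewrite lfunE.
have inr0 : ({:g} :&: lker (linfun inr) = 0)%VS.
  apply/eqP; rewrite capfv -subv0; apply/subvP=> z.
  by rewrite memv_ker lfunE /= memv0 => /eqP[->].
have Cbasis := limg_basis_of inr0 C0basis.
suff : Qspan [seq (0, z) : n | z <- C0] (0, b).
  by apply: (Qspan_linear (f := id)) => // y /memC; exact: mem_Qspan.
rewrite mapE; apply: (Qspan_rational_form (ip := ip)).
- exact: ip_eq0.
- exact: basis_free Cbasis.
- rewrite (span_basis Cbasis).
  by have := memv_img (linfun inr) (memvf b); rewrite lfunE.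
- by rewrite -mapE => y z /memC yC /memC zC; exact: (metric_rational Hip).
- rewrite -mapE => _ /mapP[c cC ->]; rewrite ip_brn.
  exact/ip_module_rational/wQ/B0invariant.
Qed.

(** For T in C0 with l(T) nonzero, the vectors u, T(u) = l(T) J and
    [u, T(u)] = l(T) <u, u> Ht are rational and still span the subalgebra. *)
Lemma plane_rational (T : subvs_of h) :
  vsval T \in C0 -> l T != 0 -> Qspan B0 u ->
  rational_subspace (chevalley_seq B0 C0) (n0_sub act u Ht).
Proof.
move=> TC lT uQ; have TuQ := B0invariant TC uQ.
exists [:: (u, 0); (l T *: J, 0); (0, (l T * N) *: vsval Ht)].
  by apply: plane_basis => //; rewrite mulf_neq0 // plane_norm_neq0.
move=> x; rewrite !inE => /or3P[] /eqP ->.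
- exact: Qspan_chevalley_module.
- by rewrite -(HuJ T).1; exact: Qspan_chevalley_module.
- have := Qspan_brn uQ TuQ.
  by rewrite (HuJ T).1 pairlZ linearZr_LR /= plane_bracket scalerA.
Qed.

End RationalPlane.
End Plane.
End Metric.

(** * The subalgebra spanned by a weight vector *)

Theorem proposition10p3
  (R : realType) (g U : vectType R)
  (br : {bilinear g -> g -> g}) (Hbr : lie_bracket br)
  (Hcompact : compact_semisimple br)
  (act : {bilinear g -> U -> U}) (Hact : lie_action br act)
  (h : {vspace g}) (Hh : maximal_abelian_subalgebra br h)
  (Phi Delta : seq (dual_cartan h))
  (HPhi : root_enum br Phi) (HDelta : root_base Phi Delta)
  (Hr : dual_cartan h -> cartan h) (HHr : root_vectors br Phi Hr)
  (X : dual_cartan h -> cplx g) (C0 : seq g)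
  (HC0 : compact_chevalley_basis br Phi Delta Hr X C0)
  (B0 BBzero : seq U) (BB : dual_cartan h -> seq U)
  (HB0 : adapted_basis act C0 B0 BBzero BB)
  (ip : {bilinear (U * g)%type -> (U * g)%type -> R | *%R & *%R})
  (Hip : adapted_metric br act B0 C0 ip)
  (brn : {bilinear (U * g)%type -> (U * g)%type -> (U * g)%type})
  (Hbrn : nilpotent_bracket act ip brn)
  (lambda : dual_cartan h) (Hlambda : nonzero_weight act lambda)
  (u : U) (Hu0 : u != 0) (Hu : real_weight_space act lambda u)
  (Ht : subvs_of h) (HHt : weight_dual_vector ip lambda Ht)
  (H2lambda : lambda *+ 2 \notin Phi) :
  [/\ \dim (n0_sub act u Ht) = 3%N,
      subalgebra brn (n0_sub act u Ht),
      totally_geodesic ip brn (n0_sub act u Ht)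
    & set_dim (center_of brn (n0_sub act u Ht)) 1] /\
  (Qspan (BB lambda) u ->
   subalgebra brn (n0_sub act u Ht) /\
   rational_subspace (chevalley_seq B0 C0) (n0_sub act u Ht)).
Proof.
have [lam0 _] := Hlambda.
pose l (H : subvs_of h) := ip (0, vsval H) (0, vsval Ht).
have lamE H : lambda (cplx_of H) = Complex 0 (l H).
  have := HHt H; rewrite -/(l H); case: (lambda _) => x y /eqP.
  rewrite eq_complex /= !mul0r !mul1r !add0r opprK => /andP[/eqP -> /eqP].
  by move/esym/eqP; rewrite oppr_eq0 => /eqP ->.
have lHt : l Ht != 0.
  apply: contraNneq lam0 => /(ip_eq0 Hip)[Ht0]; apply/eqP/dual_cartan_eq0 => H.
  by rewrite lamE /l Ht0 linear0r.
have [J HuJ] := real_weight_plane lamE Hu.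
have lE H : l H = ip (0, vsval H) (0, vsval Ht) by [].
have subalg : subalgebra brn (n0_sub act u Ht).
  exact: (plane_subalgebra Hbr Hact Hip Hbrn Hh HuJ lE lHt Hu0).
split.
  split=> //.
  - exact: (dim_plane Hip HuJ lE lHt Hu0).
  - exact: (plane_totally_geodesic Hbr Hact Hip Hbrn Hh HuJ lE lHt Hu0).
  - exact: (plane_center Hbr Hact Hip Hbrn Hh HuJ lE lHt Hu0).
move=> uQ; split=> //.
have uQ0 : Qspan B0 u.
  apply: (Qspan_linear (f := id)) uQ => // y yB; apply: mem_Qspan.
  by apply/(adapted_union HB0); right; exists lambda.
have [T TC] := exists_chevalley_torus Hh.1 HPhi HC0 lam0.
rewrite lamE eq_complex /= eqxx /= => lT.
exact: (plane_rational Hbr Hact Hip Hbrn Hh HuJ lE lHt Hu0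
  (chevalley_real_basis HC0) (adapted_invariant HB0) TC lT uQ0).
Qed.
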